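(* Let $m\ge1$, $\gamma=(1,1)$, $\chi=2m-2$. Given any system $\dot x=(-x_1^{m}x_2^{m-1},\ x_1^{m-1}x_2^{m})+\mathcal X(x)$ with $\mathcal X=(X_1,X_2)$ a formal vector series, $\mathrm{ord}_\gamma\mathcal X\ge\chi+1$ (i.e. all terms of $\mathcal X$ have ordinary degree at least $2m$), there exists a near-identity formal transformation $x=y+\mathcal Q(y)$, $\mathrm{ord}_\gamma\mathcal Q\ge1$, that brings it into the generalized normal form (GNF) $$\begin{aligned}\dot y_1={}&-y_1^{m}y_2^{m-1}+\sum_{k=2m}^\infty\Bigl(\sum_{i=0}^{m-2}Y_1^{(i,k-i)}y_1^iy_2^{k-i}+\sum_{j=0}^{m-3}Y_1^{(k-j,j)}y_1^{k-j}y_2^j\Bigr)\\&+y_1^{m+2}y_2^{m-2}\sum_{i=0}^\infty Y_1^{(i+m+2,m-2)}y_1^i+y_1^{m-1}y_2^{m+1}\sum_{j=0}^\infty Y_1^{(m-1,m+j+1)}y_2^j+y_1^my_2^m\sum_{r=0}^\infty Y_1^{(r+m+1,r+m)}y_1^{r+1}y_2^r,\end{aligned}$$ $$\begin{aligned}\dot y_2={}&y_1^{m-1}y_2^{m}+\sum_{k=2m}^\infty\Bigl(\sum_{i=0}^{m-3}Y_2^{(i,k-i)}y_1^iy_2^{k-i}+\sum_{j=0}^{m-2}Y_2^{(k-j,j)}y_1^{k-j}y_2^j\Bigr)\\&+y_1^{m+1}y_2^{m-1}\sum_{i=0}^\infty Y_2^{(i+m+1,m-1)}y_1^i+y_1^{m-2}y_2^{m+2}\sum_{j=0}^\infty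 Y_2^{(m-2,m+j+2)}y_2^j+y_1^my_2^m\sum_{r=0}^\infty Y_2^{(r+m,r+m+1)}y_1^ry_2^{r+1},\end{aligned}$$ where for each $i,j,r\ge0$ we take either $Y_1^{(i+m+2,m-2)}=0$ or $Y_2^{(i+m+1,m-1)}=0$, either $Y_1^{(m-1,m+j+1)}=0$ or $Y_2^{(m-2,m+j+2)}=0$, and either $Y_1^{(r+m+1,r+m)}=0$ or $Y_2^{(r+m,r+m+1)}=0$.
   Context: Scalars are real or complex. With weight $\gamma=(1,1)$, a vector polynomial $(P_1,P_2)$ has generalized degree $k$ if $P_1,P_2$ are homogeneous of degree $k+1$; $\mathfrak V_\gamma^{[k]}$ is the space of these. $\mathrm{ord}_\gamma$ of a vector formal series is the least generalized degree of its nonzero components ($+\infty$ for the zero series). Vector polynomials are identified with vector fields: $\mathcal P(f)=P_1\partial_1f+P_2\partial_2f$ and $[\mathcal P,\mathcal Q]=(\mathcal P(Q_1)-\mathcal Q(P_1),\mathcal P(Q_2)-\mathcal Q(P_2))$. $Y_i^{(p_1,p_2)}$ is the coefficient of $y_1^{p_1}y_2^{p_2}$ in the perturbation component $Y_i$; exponents $p_1,p_2$ are nonnegative integers, so a term whose written exponent is negative is read as zero; empty sums are zero. Generalized normal form. Let $\mathcal H$ be the unperturbed part (of generalized degree $\chi$). For $k\ge1$ let $n_k=\dim\mathfrak V_\gamma^{[k+\chi]}-\dim[\mathcal H,\mathfrak V_\gamma^{[k]}]$, and let $\mathbf a_1^k,\dots,\mathbf a_{n_k}^k$ be the coefficient vectors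 (in the standard monomial basis of $\mathfrak V_\gamma^{[k+\chi]}$) of the $n_k$ linearly independent linear conditions (resonance equations) $\langle\mathbf a_i^k,\mathbf Y_\gamma^{[k+\chi]}\rangle=\langle\mathbf a_i^k,\widetilde{\mathbf Y}_\gamma^{[k+\chi]}\rangle$ for solvability of the homological equation $[\mathcal H,\mathcal Q_\gamma^{[k]}]=\widetilde{\mathcal Y}_\gamma^{[k+\chi]}-\mathcal Y_\gamma^{[k+\chi]}$ in $\mathcal Q_\gamma^{[k]}\in\mathfrak V_\gamma^{[k]}$; here $\mathcal Q_\gamma^{[k]}$, $\mathcal Y_\gamma^{[k+\chi]}$ are the components of $\mathcal Q$, $\mathcal Y$ of the indicated generalized degree, $\widetilde{\mathcal Y}_\gamma^{[k+\chi]}$ is the term determined by the original system and by the components of $\mathcal Q$ and $\mathcal Y$ found at previous steps, and bold letters denote coefficient vectors. A coefficient of $\mathcal Y_\gamma^{[k+\chi]}$ is resonant if it really participates in at least one resonance equation. A resonant set consists, for each $k\ge1$, of $n_k$ resonant coefficients of $\mathcal Y_\gamma^{[k+\chi]}$, at positions $l_1,\dots,l_{n_k}$, such that $\det(\mathbf a^k_{i,l_j})_{i,j=1}^{n_k}\neq0$. The system $\dot y=\mathcal H(y)+\mathcal Y(y)$, $\mathrm{ord}_\gamma\mathcal Y\ge\chi+1$, is a GNF if all coefficients of $\mathcal Y$ are zero except for those from some resonant set, which have arbitrary values.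
   Formalization: For m=1 the alternative ''either Y_1^{(r+2,r+1)}=0 or Y_2^{(r+1,r+2)}=0'' fails for a GNF, so for m=1 both coefficients are kept, and the nonresonant terms Y_2^{(i+2,0)}, Y_1^{(0,j+2)} are taken zero; for m≥2 the claim is as stated. *)

(* Defs.v *)
From HB Require Import structures.
From mathcomp Require Export all_boot all_order all_algebra.
From mathcomp.multinomials Require Export mpoly.
Set Implicit Arguments.
Unset Strict Implicit.
Unset Printing Implicit Defensive.
Import GRing.Theory.
Local Open Scope ring_scope.

                                                                           
                             
Definition mon (p q : nat) : 'X_{1..2} := [multinom [tuple p; q]].

Definition chi (m : nat) : nat := (2 * m - 2)%N.

Section VectorFields.
Variable K : fieldType.

Definition vpoly := 'I_2 -> {mpoly K[2]}.

Definition vp_act (P : vpoly) (f : {mpoly K[2]}) : {mpoly K[2]} :=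
  \sum_(j < 2) P j * f^`M(j).

Definition lie (P Q : vpoly) : vpoly :=
  fun i => vp_act P (Q i) - vp_act Q (P i).

Definition unperturbed (m : nat) : vpoly := fun i =>
  if i == 0 then - 'X_[mon m (m - 1)] else 'X_[mon (m - 1) m].

                                                                              
                                                                              
Definition of_coefs k (M : 'M[K]_(2, k.+2)) : vpoly :=
  fun i => \sum_(p < k.+2) M i p *: 'X_[mon p (k.+1 - p)].

Definition coefs k (P : vpoly) : 'M[K]_(2, k.+2) :=
  \matrix_(i, p) (P i)@_(mon p (k.+1 - p)).

Definition homological m k (Q : 'M[K]_(2, k.+2)) : 'M[K]_(2, (k + chi m).+2) :=
  coefs (k + chi m) (lie (unperturbed m) (of_coefs Q)).

Definition nres (m k : nat) : nat :=
  (2 * (k + chi m).+2 - \rank (lin_mx (@homological m k)))%N.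

                                                                              
                                                              
Definition resonance_equations m k (A : 'M[K]_(nres m k, 2 * (k + chi m).+2)) :=
  row_free A /\
  forall W : 'M[K]_(2, (k + chi m).+2),
    (exists Q : 'M[K]_(2, k.+2), homological m Q = W) <->
    A *m (mxvec W)^T = 0.

                                                                              
                                                                           
                
Definition resonant_set (m : nat) (S : 'I_2 -> 'X_{1..2} -> Prop) : Prop :=
  (forall i a, S i a -> ((chi m).+1 < mdeg a)%N) /\
  forall k, (0 < k)%N ->
    exists A : 'M[K]_(nres m k, 2 * (k + chi m).+2),
    exists l : 'I_(nres m k) -> 'I_2 * 'I_(k + chi m).+2,
      let col j := mxvec_index (l j).1 (l j).2 in
      [/\ resonance_equations A,
          forall (i : 'I_2) (p : 'I_(k + chi m).+2),
            S i (mon p ((k + chi m).+1 - p)) <-> exists j, l j = (i, p),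
          forall j, exists i, A i (col j) != 0
        & \det (\matrix_(i, j) A i (col j)) != 0].

                                                                   
Definition fseries := 'X_{1..2} -> K.
Definition vseries := 'I_2 -> fseries.

Definition vseries_of (P : vpoly) : vseries := fun i a => (P i)@_a.

Definition vs_add (V W : vseries) : vseries := fun i a => V i a + W i a.

                                                                         
Definition ord_ge (n : nat) (V : vseries) : Prop :=
  forall i a, V i a != 0 -> (n < mdeg a)%N.

Definition trunc (d : nat) (f : fseries) : {mpoly K[2]} :=
  \sum_(a : 'X_{1..2 < d.+1}) f a *: 'X_[a].

                                                                               
                                                                        
Definition fs_subst (f : fseries) (g : vseries) : fseries := fun a =>
  (trunc (mdeg a) f \mPo [tuple trunc (mdeg a) (g i) | i < 2])@_a.

                           
Definition fs_act (V : vseries) (f : fseries) : fseries := fun a =>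
  (vp_act (fun j => trunc (mdeg a) (V j)) (trunc (mdeg a).+1 f))@_a.

Definition near_id (Q : vseries) : vseries :=
  vs_add (vseries_of (fun i => 'X_i)) Q.

                                                    
                                      
Definition transforms (Q V W : vseries) : Prop :=
  forall i a, fs_act W (near_id Q i) a = fs_subst (V i) (near_id Q) a.

Definition is_gnf m (S : 'I_2 -> 'X_{1..2} -> Prop) (Y : vseries) : Prop :=
  [/\ resonant_set m S, ord_ge (chi m).+1 Y
    & forall i a, ~ S i a -> Y i a = 0].

End VectorFields.

                                                                             
                                                                              
                                                                           

                                                                             
                                                                             
                                                                              
                                                            
                                                                           
                        
Inductive gnf_position (m : nat) (c1 c2 c3 : nat -> 'I_2) :
    'I_2 -> 'X_{1..2} -> Prop :=
| Pos1_low k i of (2 * m <= k)%N & (i + 2 <= m)%N :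
    gnf_position m c1 c2 c3 0 (mon i (k - i))
| Pos1_high k j of (2 * m <= k)%N & (j + 3 <= m)%N :
    gnf_position m c1 c2 c3 0 (mon (k - j) j)
| Pos1_i i of (1 < m)%N & c1 i != 0 :
    gnf_position m c1 c2 c3 0 (mon (i + m + 2) (m - 2))
| Pos1_j j of (1 < m)%N & c2 j != 0 :
    gnf_position m c1 c2 c3 0 (mon (m - 1) (m + j + 1))
| Pos1_r r of ((1 < m)%N -> c3 r != 0) :
    gnf_position m c1 c2 c3 0 (mon (r + m + 1) (r + m))
| Pos2_low k i of (2 * m <= k)%N & (i + 3 <= m)%N :
    gnf_position m c1 c2 c3 1 (mon i (k - i))
| Pos2_high k j of (2 * m <= k)%N & (j + 2 <= m)%N :
    gnf_position m c1 c2 c3 1 (mon (k - j) j)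
| Pos2_i i of (1 < m)%N & c1 i != 1 :
    gnf_position m c1 c2 c3 1 (mon (i + m + 1) (m - 1))
| Pos2_j j of (1 < m)%N & c2 j != 1 :
    gnf_position m c1 c2 c3 1 (mon (m - 2) (m + j + 2))
| Pos2_r r of ((1 < m)%N -> c3 r != 1) :
    gnf_position m c1 c2 c3 1 (mon (r + m) (r + m + 1)).

(* Main.v *)
(** On a homogeneous field of degree k+1 the operator [H, .] with
    H = (x1 x2)^n (-x1, x2), n = m - 1, splits into blocks of size at most two:
    the terms a x1^t x2^(k+1-t) e1 and b x1^(t-1) x2^(k+2-t) e2 only produce
      ((d + n) a + n b) x1^(t+n) x2^(k+n+1-t) e1
        + ((d - n) b - n a) x1^(t+n-1) x2^(k+n+2-t) e2,  d = k + 2 - 2t,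
    a block of determinant d^2.  It is invertible unless 2t = k + 2 or it is cut
    to a single column (t = 0, where b is absent, and t = k + 2, where a is), and
    in those cases, when n > 0, the image is a line of the plane that meets both
    coordinate axes trivially.  So the coordinate subspace of the GNF positions
    is a complement of the image of [H, .] in each degree.  This gives at once the
    number of resonance equations, the nonvanishing determinant, and the
    solvability of the homological equation with a right-hand side corrected in
    GNF positions; the transformation is then built degree by degree. *)

From HB Require Import structures.
Require Import Defs.
From mathcomp Require Import all_boot all_order all_algebra.
From mathcomp.multinomials Require Import mpoly.
From mathcomp Require Import zify ring.
Set Implicit Arguments.
Unset Strict Implicit.
Unset Printing Implicit Defensive.
Import GRing.Theory Num.Theory.

(** * Order filtration on polynomials *)

Section OrderFiltration.
Local Open Scope ring_scope.
Variables (K : fieldType) (n : nat).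
Implicit Types (p q : {mpoly K[n]}) (a : 'X_{1..n}).

(** A lower bound on the order in ordinary degree, phrased through coefficients so that the zero
    polynomial satisfies every bound. *)
Definition mord d p := forall a, (mdeg a < d)%N -> p@_a = 0.

Lemma mordW d e p : (e <= d)%N -> mord d p -> mord e p.
Proof. by move=> le_ed dp a lta; apply: dp; apply: leq_trans le_ed. Qed.

Lemma mord0 d : mord d 0.
Proof. by move=> a _; rewrite mcoeff0. Qed.

Lemma mordn0 p : mord 0 p.
Proof. by []. Qed.

Lemma mordD d p q : mord d p -> mord d q -> mord d (p + q).
Proof. by move=> dp dq a lta; rewrite mcoeffD dp ?dq ?addr0. Qed.

Lemma mordN d p : mord d p -> mord d (- p).
Proof. by move=> dp a lta; rewrite mcoeffN dp ?oppr0. Qed.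

Lemma mordZ d c p : mord d p -> mord d (c *: p).
Proof. by move=> dp a lta; rewrite mcoeffZ dp ?mulr0. Qed.

Lemma mord_sum d (I : Type) (r : seq I) (P : pred I) (F : I -> {mpoly K[n]}) :
  (forall i, P i -> mord d (F i)) -> mord d (\sum_(i <- r | P i) F i).
Proof. by move=> dF; apply: big_ind => //; [exact: mord0|exact: mordD]. Qed.

Lemma mordM d e p q : mord d p -> mord e q -> mord (d + e) (p * q).
Proof.
move=> dp eq a lta; rewrite mcoeffM big1 // => k /eqP def_a.
have [lt1|ge1] := ltnP (mdeg k.1) d; first by rewrite dp ?mul0r.
rewrite eq ?mulr0 // -(ltn_add2l (mdeg k.1)) -mdegD -def_a.
by apply: leq_trans lta _; rewrite leq_add2r.
Qed.

Lemma mord_deriv d p i : mord d p -> mord d.-1 p^`M(i).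
Proof.
move=> dp a lta; rewrite mcoeff_mderiv dp ?mul0rn //.
rewrite mdegD mdeg1; lia.
Qed.

Lemma mordX a : mord (mdeg a) 'X_[a].
Proof. by move=> b ltb; rewrite mcoeffX; case: eqP ltb => // ->; rewrite ltnn. Qed.

(* The graded index lets one carry estimates that improve with the order of the
   polynomial; it suffices to check variables, products and linear combinations. *)
Lemma mord_ind (P : nat -> {mpoly K[n]} -> Prop) :
    (forall d e p, (e <= d)%N -> P d p -> P e p) ->
    (forall d, P d 0) ->
    (forall d c p q, P d p -> P d q -> P d (c *: p + q)) ->
    P 0%N 1 -> (forall i, P 1%N 'X_i) ->
    (forall d e p q, P d p -> P e q -> P (d + e)%N (p * q)) ->
  forall d p, mord d p -> P d p.
Proof.
move=> PW P0 PZD P1 PX PM d p dp.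
have Pmon a : P (mdeg a) 'X_[a].
  rewrite mpolyXE_id mdegE; apply: (big_ind2 P) => //.
  - by move=> x1 x2 y1 y2; apply: PM.
  - move=> i _; elim: (a i) => [|l IHl]; first by rewrite expr0.
    by rewrite exprS -add1n; apply: PM.
rewrite [p]mpolyE big_seq; apply: (big_ind (P d)) => //.
- by move=> x y Px Py; rewrite -[x]scale1r; apply: PZD.
- move=> a; rewrite mcoeff_msupp => nz; rewrite -[_ *: _]addr0; apply: PZD => //.
  apply: PW (Pmon a); rewrite leqNgt; apply/negP => /dp pa.
  by rewrite pa eqxx in nz.
Qed.

End OrderFiltration.

(** * Substitution, derivations and first-order Taylor estimates *)

Lemma mulr_subM (R : comNzRingType) (x y x' y' : R) :
  (x' * y' - x * y = x' * (y' - y) + (x' - x) * y)%R.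
Proof. by ring. Qed.

(* [x1, y1] are the factors after a substitution, [x2, y2] after a perturbation
   of it with first variation [dx, dy]. *)
Lemma mulr_taylor (R : comNzRingType) (x x1 x2 dx y y1 y2 dy : R) :
  (x2 * y2 - x1 * y1 - (dx * y + x * dy) =
    (x2 - x1 - dx) * (y + (y1 - y)) + (x + (x1 - x)) * (y2 - y1 - dy)
    + (x2 - x1 - dx + dx) * (y2 - y1 - dy + dy) + dx * (y1 - y) + (x1 - x) * dy)%R.
Proof. by ring. Qed.

Section Composition.
Local Open Scope ring_scope.
Variables (K : fieldType).
Implicit Types (P Q g h : vpoly K) (f : {mpoly K[2]}).

Definition vcomp f g := f \mPo [tuple g i | i < 2].

Lemma vcompXU i g : vcomp 'X_i g = g i.
Proof. by rewrite /vcomp comp_mpolyXU -tnth_nth tnth_mktuple. Qed.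

Lemma vcomp0 g : vcomp 0 g = 0. Proof. exact: raddf0. Qed.

Lemma vcompB f1 f2 g : vcomp (f1 - f2) g = vcomp f1 g - vcomp f2 g.
Proof. exact: raddfB. Qed.

Lemma vcompZD c f1 f2 g : vcomp (c *: f1 + f2) g = c *: vcomp f1 g + vcomp f2 g.
Proof. by rewrite /vcomp comp_mpolyD comp_mpolyZ. Qed.

Lemma vcomp1 g : vcomp 1 g = 1.
Proof. exact: comp_mpoly1. Qed.

Lemma vcompM f1 f2 g : vcomp (f1 * f2) g = vcomp f1 g * vcomp f2 g.
Proof. exact: rmorphM. Qed.

Lemma mord_vcomp d f g :
  (forall i, mord 1 (g i)) -> mord d f -> mord d (vcomp f g).
Proof.
move=> dg; move: d f; apply: mord_ind.
- by move=> d e p; apply: mordW.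
- by move=> d; rewrite vcomp0; apply: mord0.
- by move=> d c p q dp dq; rewrite vcompZD; apply/mordD/dq/mordZ.
- exact: mordn0.
- by move=> i; rewrite vcompXU.
- by move=> d e p q dp eq; rewrite vcompM; apply: mordM.
Qed.

(** Both substitutions are ring morphisms, so their difference on a product telescopes by
    [mulr_subM], and the error is never amplified. *)
Lemma vcomp_congr e f g g' :
  (forall i, mord e (g' i - g i)) -> mord e (vcomp f g' - vcomp f g).
Proof.
move=> dg.
pose D p := vcomp p g' - vcomp p g.
suff: forall d p, mord d p -> mord e (D p) by apply; apply: mordn0.
apply: mord_ind => [_ _ p _|_|_ c p q dp dq||i|_ _ p q dp dq]; rewrite /D.
- by [].
- by rewrite !vcomp0 subrr; apply: mord0.
- rewrite !vcompZD opprD addrACA -scalerBr; exact/mordD/dq/mordZ.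
- by rewrite !vcomp1 subrr; apply: mord0.
- by rewrite !vcompXU.
- rewrite !vcompM mulr_subM.
  apply: mordD; first by rewrite -[e]add0n; apply: mordM.
  by rewrite -[e]addn0; apply: mordM.
Qed.

Lemma vp_actZD P c f1 f2 : vp_act P (c *: f1 + f2) = c *: vp_act P f1 + vp_act P f2.
Proof.
rewrite /vp_act scaler_sumr -big_split; apply: eq_bigr => j _ /=.
by rewrite mderivD mderivZ mulrDr scalerAr.
Qed.

Lemma vp_actD P f1 f2 : vp_act P (f1 + f2) = vp_act P f1 + vp_act P f2.
Proof. by rewrite -[f1 in LHS]scale1r vp_actZD scale1r. Qed.

Lemma vp_actB P f1 f2 : vp_act P (f1 - f2) = vp_act P f1 - vp_act P f2.
Proof. by rewrite addrC -scaleN1r vp_actZD scaleN1r addrC. Qed.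

Lemma vp_act0 P : vp_act P 0 = 0.
Proof. by rewrite -[0 in LHS](subrr 0) vp_actB subrr. Qed.

Lemma vp_actDl P Q f : vp_act (fun i => P i + Q i) f = vp_act P f + vp_act Q f.
Proof. by rewrite /vp_act -big_split; apply: eq_bigr => j _; rewrite mulrDl. Qed.

Lemma vp_actBl P Q f : vp_act (fun i => P i - Q i) f = vp_act P f - vp_act Q f.
Proof.
by rewrite /vp_act -sumrB; apply: eq_bigr => j _; rewrite mulrBl.
Qed.

Lemma vp_act1 P : vp_act P 1 = 0.
Proof. by rewrite /vp_act big1 // => j _; rewrite -mpolyC1 mderivC mulr0. Qed.

Lemma vp_actXU P i : vp_act P 'X_i = P i.
Proof.
rewrite /vp_act (bigD1 i) //= big1 ?addr0 => [|j /negPf ji].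
  by rewrite mderivX mnm1E eqxx scale1r (_ : U_(i) - U_(i) = 0)%MM ?mpolyX0 ?mulr1 //; apply/mnmP => l; rewrite mnmBE subnn mnm0E.
by rewrite mderivX mnm1E eq_sym ji scale0r mulr0.
Qed.

Lemma vp_actM P f1 f2 : vp_act P (f1 * f2) = vp_act P f1 * f2 + f1 * vp_act P f2.
Proof.
rewrite /vp_act mulr_suml mulr_sumr -big_split; apply: eq_bigr => j _ /=.
by rewrite mderivM mulrDr; congr (_ + _); [exact: mulrA|exact: mulrCA].
Qed.

Lemma mord_vp_act d e P f :
  (forall i, mord d (P i)) -> mord e f -> mord (d + e.-1) (vp_act P f).
Proof.
by move=> dP ef; apply: mord_sum => j _; apply: mordM => //; apply: mord_deriv.
Qed.

(** The first variation has order d + k. What is dropped is either quadratic in [h] or comes from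
    differentiating at the identity instead of at [g]; both gain at least one degree. *)
Lemma vcomp_taylor k d f g h : (0 < k)%N ->
    (forall i, mord 2 (g i - 'X_i)) -> (forall i, mord k.+1 (h i)) ->
    mord d f ->
  mord (d + k).+1 (vcomp f (fun i => g i + h i) - vcomp f g - vp_act h f).
Proof.
move=> k0 dg dh df.
pose R p := vcomp p (fun i => g i + h i) - vcomp p g - vp_act h p.
pose S p := vcomp p g - p.
(* The remainder of a product involves the coarser bounds on its factors, so the four estimates go
   through the induction together. *)
suff: [/\ mord d f, mord d.+1 (S f), mord (d + k) (vp_act h f)
        & mord (d + k).+1 (R f)] by case.
move: d f df; apply: mord_ind.
- move=> d e p le_ed [p1 p2 p3 p4]; split.
  + exact: mordW p1.
  + by apply: mordW p2.
  + by apply: mordW p3; rewrite leq_add2r.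
  + by apply: mordW p4; rewrite ltnS leq_add2r.
- by move=> d; rewrite /R /S vp_act0 !vcomp0 !subr0; split; apply: mord0.
- move=> d c p q [p1 p2 p3 p4] [q1 q2 q3 q4]; split.
  + by apply/mordD/q1/mordZ.
  + rewrite /S vcompZD opprD addrACA -scalerBr; exact/mordD/q2/mordZ.
  + rewrite vp_actZD; exact/mordD/q3/mordZ.
  + rewrite /R !vcompZD vp_actZD !opprD (addrACA (c *: _)) [X in mord _ X]addrACA.
    rewrite -!scalerBr; exact/mordD/q4/mordZ.
- rewrite /R /S vp_act1 !vcomp1 subrr subr0; split=> //; exact: mord0.
- move=> i; rewrite /R /S vp_actXU !vcompXU; split=> //.
  + by have := @mordX K _ U_(i)%MM; rewrite mdeg1.
  + by rewrite (addrC (g i)) addrK subrr; apply: mord0.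
- move=> d e p q [p1 p2 p3 p4] [q1 q2 q3 q4]; split; first exact: mordM.
  + rewrite /S vcompM mulr_subM.
    have Mp : mord d (vcomp p g) by rewrite -[vcomp p g](subrK p); apply/mordD/p1/mordW/p2.
    by apply: mordD; [rewrite -addnS; apply: mordM|rewrite -addSn; apply: mordM].
  + rewrite vp_actM; apply: mordD.
      by rewrite addnAC; apply: mordM.
    by rewrite -addnA; apply: mordM.
  + rewrite /R !vcompM vp_actM mulr_taylor -/(S p) -/(S q) -/(R p) -/(R q).
    have Mq : mord e (q + S q) by apply: mordD => //; apply: mordW q2.
    have Mp : mord d (p + S p) by apply: mordD => //; apply: mordW p2.
    do !apply: mordD.
    * apply: mordW (mordM p4 Mq); lia.
    * apply: mordW (mordM Mp q4); lia.
    (* The product of two first variations has order d + e + 2k; here k > 0 is what brings it past d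
       + e + k. *)
    * have Mp' : mord (d + k) (R p + vp_act h p) by apply: mordD => //; apply: mordW p4.
      have Mq' : mord (e + k) (R q + vp_act h q) by apply: mordD => //; apply: mordW q4.
      apply: mordW (mordM Mp' Mq'); lia.
    * apply: mordW (mordM p3 q2); lia.
    * apply: mordW (mordM p2 q3); lia.
Qed.

End Composition.

(** * Coordinate subspaces complementary to a row space *)

Section CoordinateComplement.
Local Open Scope ring_scope.
Variables (F : fieldType) (M N s : nat) (H : 'M[F]_(M, N)) (l : 'I_s -> 'I_N).
Hypothesis l_inj : injective l.

Definition supported (w : 'rV[F]_N) := forall j, (forall i, l i != j) -> w 0 j = 0.

Hypothesis H_indep : forall w, (w <= H)%MS -> supported w -> w = 0.
Hypothesis H_span : forall w, exists2 u, (u <= H)%MS & supported (w - u).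

(** The rows are the unit vectors at the positions [l i], so the row space of [B] is the coordinate
    subspace of the supported vectors. *)
Let B := rowsub l (1%:M : 'M[F]_N).

Let mulBE (v : 'rV[F]_s) i : (v *m B) 0 (l i) = v 0 i.
Proof.
rewrite mxE (bigD1 i) //= big1 ?addr0 => [|j ji]; rewrite !mxE ?eqxx ?mulr1 //.
by rewrite (inj_eq l_inj) (negPf ji) mulr0.
Qed.

Let mulB_supported (v : 'rV[F]_s) : supported (v *m B).
Proof.
by move=> j lj; rewrite mxE big1 // => i _; rewrite !mxE (negPf (lj i)) mulr0.
Qed.

Let supportedP (w : 'rV[F]_N) : supported w -> (w <= B)%MS.
Proof.
move=> sw; apply/submxP; exists (\row_i w 0 (l i)); apply/rowP=> j.
case: (pickP (fun i => l i == j)) => [i /eqP <-|no_i]; first by rewrite mulBE mxE.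
by rewrite sw ?mulB_supported // => i; rewrite no_i.
Qed.

Let B_free : row_free B.
Proof.
by apply: inj_row_free => v vB0; apply/rowP=> i; rewrite -mulBE vB0 !mxE.
Qed.

Let sub_eq0 (v : 'rV[F]_s) : (v *m B <= H)%MS -> v = 0.
Proof.
move=> vH; apply/rowP=> i; rewrite -mulBE (H_indep vH) ?mxE //.
Qed.

Lemma complement_rank : s = (N - \rank H)%N.
Proof.
have cap0 : (H :&: B)%MS = 0.
  apply/eqP/rowV0P => w; rewrite sub_capmx => /andP[wH /submxP[v def_w]].
  by move: wH; rewrite def_w => /sub_eq0 ->; rewrite mul0mx.
have sumT : \rank (H + B)%MS = N.
  apply/eqP; rewrite -[_ == N]/(row_full _) -sub1mx; apply/row_subP => i.
  have [u uH sw] := H_span (row i 1%:M).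
  by rewrite -[row i _](subrK u) addrC addmx_sub_adds ?supportedP.
move: (mxrank_sum_cap H B); rewrite cap0 mxrank0 sumT (eqP B_free); lia.
Qed.

(** The rows of [A] form a basis of the annihilator of the row space of [H]. A vector killed by the
    minor at the positions [l] extends by zero to a supported vector satisfying all equations, hence
    lying in [H], hence zero. *)
Lemma complement_equations : exists A : 'M[F]_(s, N),
  [/\ row_free A, forall w : 'rV[F]_N, (w <= H)%MS <-> A *m w^T = 0
    & \det (\matrix_(i, j) A i (l j)) != 0].
Proof.
have : exists A : 'M[F]_(s, N),
    row_free A /\ forall w : 'rV[F]_N, (w <= H)%MS <-> A *m w^T = 0.
  (* The number of rows occurs in the type of [A]; making it a variable allows the rank to be
     substituted for it. *)
  suff coker_eq s' : s' = \rank (cokermx H)^T -> exists A : 'M[F]_(s', N),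
      row_free A /\ forall w : 'rV[F]_N, (w <= H)%MS <-> A *m w^T = 0.
    by apply: coker_eq; rewrite mxrank_tr mxrank_coker -complement_rank.
  move=> ->.
  exists (row_base (cokermx H)^T); split=> [|w]; first exact: row_base_free.
  rewrite submxE; split => [/eqP wC|wC].
    apply/eqP; rewrite -sub_kermx eq_row_base sub_kermx.
    by rewrite -trmx_mul wC trmx0.
  have: (row_base (cokermx H)^T <= kermx w^T)%MS by rewrite sub_kermx wC.
  by rewrite eq_row_base sub_kermx -trmx_mul -trmx0 (inj_eq trmx_inj).
case=> A [Afree HA]; exists A; split=> //.
rewrite -det_tr -unitfE -unitmxE -row_free_unit.
apply: inj_row_free => v vA0; apply: sub_eq0; apply/HA.
rewrite -[LHS]trmxK trmx_mul trmxK -trmx0; congr (_^T).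
rewrite -[RHS]vA0 -mulmxA; congr (_ *m _); apply/matrixP=> i j.
rewrite !mxE (bigD1 (l i)) //= big1 ?addr0 => [|c /negPf lc]; rewrite !mxE.
  by rewrite eqxx mul1r.
by rewrite eq_sym lc mul0r.
Qed.

End CoordinateComplement.

(** * Decidable form of the GNF positions *)

Section Positions.
Variables (m : nat) (c1 c2 c3 : nat -> 'I_2).

(** The parameters of each family are read off from the exponents. For m = 1 there is no choice on
    the diagonal: both resonant coefficients are kept. *)
Definition gnf_positionb (i : 'I_2) (p q : nat) : bool :=
  if i == ord0 then
    [|| p + 2 <= m, q + 3 <= m,
        [&& 1 < m, q == m - 2 & c1 (p - (m + 2)) != ord0],
        [&& 1 < m, p == m - 1 & c2 (q - (m + 1)) != ord0]
      | [&& p == q.+1, m <= q & (1 < m) ==> (c3 (q - m) != ord0)]]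
  else
    [|| p + 3 <= m, q + 2 <= m,
        [&& 1 < m, q == m - 1 & c1 (p - (m + 1)) == ord0],
        [&& 1 < m, p == m - 2 & c2 (q - (m + 2)) == ord0]
      | [&& q == p.+1, m <= p & (1 < m) ==> (c3 (p - m) == ord0)]].

Lemma ord2_neq1 (i : 'I_2) : (i != 1%R) = (i == ord0).
Proof. by case: i => [[|[|]]]. Qed.

Lemma ord2_ind (P : 'I_2 -> Prop) : P ord0 -> P 1%R -> forall i, P i.
Proof.
move=> P0 P1 i; case: (eqVneq i ord0) => [->|] //.
by rewrite -ord2_neq1 negbK => /eqP ->.
Qed.


Lemma mon0 p q : mon p q ord0 = p. Proof. by []. Qed.

Lemma mon1 p q : mon p q 1%R = q. Proof. by []. Qed.

Lemma mon_eta (a : 'X_{1..2}) : a = mon (a ord0) (a 1%R).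
Proof.
by apply/mnmP => i; case: i => [[|[|]]] // lt; congr (a _); apply: val_inj.
Qed.

Lemma mdeg_mon p q : mdeg (mon p q) = p + q.
Proof. by rewrite mdegE big_ord_recl big_ord1. Qed.

Lemma eq_mon p q p' q' : (mon p q == mon p' q') = (p == p') && (q == q').
Proof.
apply/eqP/andP => [e|[/eqP-> /eqP->] //].
by split; apply/eqP; [rewrite -(mon0 p q) e|rewrite -(mon1 p q) e].
Qed.

Lemma mcoeff_mon (R : nzRingType) p q u v : p + q = u + v ->
  ('X_[mon p q]@_(mon u v) = (p == u)%:R :> R)%R.
Proof.
move=> e; rewrite mcoeffX eq_mon; congr (_%:R)%R; congr nat_of_bool.
apply/andP/idP => [[] //|/eqP pu]; split; apply/eqP; lia.
Qed.

Lemma addm_mon p q p' q' : (mon p q + mon p' q')%MM = mon (p + p') (q + q').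
Proof. by rewrite [LHS]mon_eta !mnmDE. Qed.

(** The degree bound restores the condition 2m <= k of the low and high families, which the boolean
    version omits. *)
Lemma gnf_positionP i p q : 0 < m -> 2 * m <= p + q ->
  reflect (gnf_position m c1 c2 c3 i (mon p q)) (gnf_positionb i p q).
Proof.
move=> m0 le_pq; apply: (iffP idP); last first.
  move def_a: (mon p q) => a Sa.
  case: Sa def_a => [k j h1 h2|k j h1 h2|j h1 h2|j h1 h2|r h|k j h1 h2|k j h1 h2|j h1 h2|j h1 h2|r h]
    /eqP; rewrite eq_mon => /andP[/eqP ? /eqP ?]; subst; rewrite /gnf_positionb /=.
  - by rewrite h2.
  - by rewrite h2 orbT.
  - rewrite h1 eqxx (_ : j + m + 2 - (m + 2) = j) ?h2 ?orbT //; lia.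
  - rewrite h1 eqxx (_ : m + j + 1 - (m + 1) = j) ?h2 ?orbT //; lia.
  - rewrite addn1 eqxx leq_addl addnK; case: ltnP h => [_ ->|_ _] //; rewrite !orbT //.
  - by rewrite h2.
  - by rewrite h2 orbT.
  - rewrite h1 eqxx (_ : j + m + 1 - (m + 1) = j) -?ord2_neq1 ?h2 ?orbT //; lia.
  - rewrite h1 eqxx (_ : m + j + 2 - (m + 2) = j) -?ord2_neq1 ?h2 ?orbT //; lia.
  - rewrite addn1 eqxx leq_addl addnK; case: ltnP h => [_|_ _]; last by rewrite !orbT.
    by move=> /(_ isT); rewrite ord2_neq1 => ->; rewrite !orbT.
rewrite /gnf_positionb; case: eqP => [->|/eqP].
  case/or4P => [h|h|/and3P[h1 /eqP e h2]|/orP[/and3P[h1 /eqP e h2]|/and3P[/eqP e h1 /implyP h2]]].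
  - by rewrite (_ : q = p + q - p); [apply: Pos1_low|lia].
  - by rewrite (_ : p = p + q - q); [apply: Pos1_high|lia].
  - by rewrite e (_ : p = p - (m + 2) + m + 2); [apply: Pos1_i|lia].
  - by rewrite e (_ : q = m + (q - (m + 1)) + 1); [apply: Pos1_j|lia].
  - by have := @Pos1_r m c1 c2 c3 (q - m) h2; rewrite subnK // addn1 e.
rewrite -ord2_neq1 negbK => /eqP ->.
case/or4P => [h|h|/and3P[h1 /eqP e h2]|/orP[/and3P[h1 /eqP e h2]|/and3P[/eqP e h1 /implyP h2]]].
- by rewrite (_ : q = p + q - p); [apply: Pos2_low|lia].
- by rewrite (_ : p = p + q - q); [apply: Pos2_high|lia].
- by rewrite e (_ : p = p - (m + 1) + m + 1); [apply: Pos2_i; rewrite ?ord2_neq1|lia].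
- by rewrite e (_ : q = m + (q - (m + 2)) + 2); [apply: Pos2_j; rewrite ?ord2_neq1|lia].
- have := @Pos2_r m c1 c2 c3 (p - m); rewrite subnK // addn1 e; apply=> /h2.
  by rewrite ord2_neq1.
Qed.

End Positions.

(** * Linear algebra of a single block *)

Section LocalBlocks.
Local Open Scope ring_scope.
Variables (K : numFieldType) (n k : nat) (c1 c2 c3 : nat -> 'I_2).
Hypothesis k_gt0 : (0 < k)%N.

(* In the block of index [t], [x] is the coefficient of [x1^t x2^(k+1-t)] in the
   first component and [y] that of [x1^(t-1) x2^(k+2-t)] in the second. *)
Definition gap (t : nat) : K := k.+2%:R - (2 * t)%:R.

Definition block0 t (x y : K) := (gap t + n%:R) * x + n%:R * y.
Definition block1 t (x y : K) := (gap t - n%:R) * y - n%:R * x.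

(** The exponents are those of the two outputs of block [t]. For n = 0 the first output does not
    exist at t = k + 2, nor the second at t = 0; the bounds [t <= k + n + 1] and [0 < t + n] below
    exclude these truncated subtractions. *)
Definition sel0 t := gnf_positionb n.+1 c1 c2 c3 ord0 (t + n) (k + n + 1 - t).
Definition sel1 t := gnf_positionb n.+1 c1 c2 c3 1 (t + n - 1) (k + n + 2 - t).

(* [true] when the first component of block [t] is the one set to zero. *)
Definition choice_at t : bool :=
  (if t == 0%N then c2 (k - 1) else if t == k.+2 then c1 (k - 1) else c3 (k - t))
  == ord0.

Definition special t := [|| t == 0, t == k.+2 | (2 * t == k.+2)]%N.

(** For n = 0 the central block is zero and both its outputs are selected. For n > 0 a special block
    has a line as image, and [choice_at] leaves one output selected, this one or that of [sel1E]. *)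
Lemma sel0E t : (t <= k.+2)%N -> (t <= k + n + 1)%N ->
  sel0 t = if n == 0%N then (2 * t == k.+2)%N else special t && ~~ choice_at t.
Proof.
move=> le_t le_tn; rewrite /sel0 /gnf_positionb /special /choice_at eqxx.
case: n le_tn => [|n'] le_tn.
  rewrite /=; apply/idP/idP; lia.
rewrite !ltnS /=.
have [->|t0] := eqVneq t 0%N.
  rewrite (_ : k + n'.+1 + 1 - 0 - (n'.+2 + 1) = k - 1)%N; last lia.
  case: (c2 _ != _); rewrite ?andbT ?andbF; lia.
have [->|tk] := eqVneq t k.+2.
  rewrite (_ : k.+2 + n'.+1 - (n'.+2 + 2) = k - 1)%N; last lia.
  case: (c1 _ != _); rewrite ?andbT ?andbF; lia.
have [ht|ht] := eqVneq (2 * t)%N k.+2.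
  rewrite (_ : k + n'.+1 + 1 - t - n'.+2 = k - t)%N; last lia.
  case: (c3 _ != _); rewrite ?andbT ?andbF; lia.
lia.
Qed.

Lemma sel1E t : (t <= k.+2)%N -> (0 < t + n)%N ->
  sel1 t = if n == 0%N then (2 * t == k.+2)%N else special t && choice_at t.
Proof.
move=> le_t le_tn; rewrite /sel1 /gnf_positionb /special /choice_at /=.
case: n le_tn => [|n'] le_tn.
  rewrite /=; apply/idP/idP; lia.
rewrite !ltnS /=.
have [->|t0] := eqVneq t 0%N.
  rewrite (_ : k + n'.+1 + 2 - 0 - (n'.+2 + 2) = k - 1)%N; last lia.
  case: (c2 _ == _); rewrite ?andbT ?andbF; lia.
have [->|tk] := eqVneq t k.+2.
  rewrite (_ : k.+2 + n'.+1 - 1 - (n'.+2 + 1) = k - 1)%N; last lia.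
  case: (c1 _ == _); rewrite ?andbT ?andbF; lia.
have [ht|ht] := eqVneq (2 * t)%N k.+2.
  (* The exponent gives the index t - 2, which is k - t because 2t = k + 2. *)
  rewrite (_ : t + n'.+1 - 1 - n'.+2 = k - t)%N; last lia.
  case: (c3 _ == _); rewrite ?andbT ?andbF; lia.
lia.
Qed.

Lemma gap_eq0 t : (gap t == 0) = (2 * t == k.+2)%N.
Proof. by rewrite subr_eq0 eqr_nat eq_sym. Qed.

Lemma gap0 : gap 0 = k.+2%:R.
Proof. by rewrite /gap muln0 subr0. Qed.

Lemma gap_max : gap k.+2 = - k.+2%:R.
Proof. by rewrite /gap mul2n -addnn natrD opprD addNKr. Qed.

(** Non-special blocks have no selected output when n > 0. In a special one the image is a line
    transverse to both axes, so one vanishing output forces the other to vanish. The conditions on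
    [x] and [y] encode the missing columns at the two ends. *)
Lemma block_indep t x y : (t <= k.+2)%N ->
    (t = k.+2 -> x = 0) -> (t = 0%N -> y = 0) ->
    ((t <= k + n + 1)%N -> ~~ sel0 t -> block0 t x y = 0) ->
    ((0 < t + n)%N -> ~~ sel1 t -> block1 t x y = 0) ->
  ((t <= k + n + 1)%N -> block0 t x y = 0) /\ ((0 < t + n)%N -> block1 t x y = 0).
Proof.
move=> le_t x0 y0 h0 h1; have [n0|n0] := eqVneq n 0%N.
  have nR : n%:R = 0 :> K by rewrite n0.
  split=> lt_t.
    have [center|noncenter] := boolP (2 * t == k.+2)%N.
      by move: center; rewrite /block0 -gap_eq0 nR => /eqP->; rewrite addr0 !mul0r addr0.
    by apply: h0 => //; rewrite sel0E // n0.
  have [center|noncenter] := boolP (2 * t == k.+2)%N.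
    by move: center; rewrite /block1 -gap_eq0 nR => /eqP->; rewrite subr0 !mul0r subr0.
  by apply: h1 => //; rewrite sel1E // n0.
have nR : n%:R != 0 :> K by rewrite pnatr_eq0.
have kR : k.+2%:R + n%:R != 0 :> K by rewrite -natrD pnatr_eq0.
have kR' : - k.+2%:R - n%:R != 0 :> K by rewrite -opprD oppr_eq0.
have le0 : (t <= k + n + 1)%N by lia.
have le1 : (0 < t + n)%N by lia.
move: (h0 le0) (h1 le1); rewrite sel0E // sel1E // (negPf n0) => {}h0 {}h1.
suff [] : block0 t x y = 0 /\ block1 t x y = 0 by [].
have [spec|nspec] := boolP (special t); last by rewrite h0 ?h1 ?(negPf nspec).
have [center|noncenter] := eqVneq (2 * t)%N k.+2.
  (* With zero gap the two outputs are n(x + y) and its opposite. *)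
  have opp : block1 t x y = - block0 t x y.
    by rewrite /block0 /block1 (eqP (_ : gap t == 0)) ?gap_eq0 ?center //; ring.
  have [w0|w1] : block0 t x y = 0 \/ block1 t x y = 0.
    by case: (choice_at t) h0 h1; [left; apply: h0|right; apply: h1]; rewrite andbF.
    by rewrite opp w0 oppr0.
  by split=> //; rewrite -[block0 _ _ _]opprK -opp w1 oppr0.
(* At an end only one unknown is left, and it enters both outputs with nonzero coefficients, up to
   sign n and k + 2 + n. *)
have [x_eq0 y_eq0] : x = 0 /\ y = 0; last first.
  by rewrite /block0 /block1 x_eq0 y_eq0 !mulr0 addr0 subr0.
have w01 : block0 t x y = 0 \/ block1 t x y = 0.
  by case: (choice_at t) h0 h1; [left; apply: h0|right; apply: h1]; rewrite andbF.
move: spec; rewrite /special (negPf noncenter) orbF => /orP[/eqP t0|/eqP tk].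
  split; last exact: y0; apply/eqP.
  move: w01; rewrite /block0 /block1 t0 gap0 (y0 t0) !mulr0 addr0 add0r.
  by case=> /eqP; rewrite ?oppr_eq0 mulf_eq0 ?(negPf nR) ?(negPf kR).
split; first exact: x0; apply/eqP.
move: w01; rewrite /block0 /block1 tk gap_max (x0 tk) !mulr0 add0r subr0.
by case=> /eqP; rewrite mulf_eq0 ?(negPf nR) ?(negPf kR').
Qed.

Lemma block_solve t (w0 w1 : K) : (t <= k.+2)%N -> exists xy : K * K,
  [/\ t = k.+2 -> xy.1 = 0, t = 0%N -> xy.2 = 0,
    (t <= k + n + 1)%N -> ~~ sel0 t -> w0 = block0 t xy.1 xy.2
  & (0 < t + n)%N -> ~~ sel1 t -> w1 = block1 t xy.1 xy.2].
Proof.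
move=> le_t; have [n0|n0] := eqVneq n 0%N.
  have nR : n%:R = 0 :> K by rewrite n0.
  (* The block is diagonal with both entries equal to the gap. At the centre the gap is zero, but
     there both outputs are selected and nothing has to be solved. *)
  exists (if t == k.+2 then 0 else w0 / gap t, if t == 0%N then 0 else w1 / gap t).
  rewrite /block0 /block1 !nR /=; split=> [->|->|le0|le1]; rewrite ?eqxx //.
    rewrite sel0E // n0 eqxx -gap_eq0 => gap_t.
    rewrite ifF; last by apply/eqP; lia.
    by rewrite mul0r !addr0 mulrC divfK.
  rewrite sel1E // n0 eqxx -gap_eq0 => gap_t.
  rewrite ifF; last by apply/eqP; lia.
  by rewrite mul0r !subr0 mulrC divfK.
have nR : n%:R != 0 :> K by rewrite pnatr_eq0.
have kR : k.+2%:R + n%:R != 0 :> K by rewrite -natrD pnatr_eq0.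
have kR' : - k.+2%:R - n%:R != 0 :> K by rewrite -opprD oppr_eq0.
have le0 : (t <= k + n + 1)%N by lia.
have le1 : (0 < t + n)%N by lia.
rewrite sel0E // sel1E // (negPf n0).
have [spec|nspec] := boolP (special t); last first.
  move: nspec; rewrite /special -gap_eq0 => /norP[/negPf t0 /norP[/negPf tk gap_t]].
  (* Cramer's rule for the block, whose determinant is the square of the gap. *)
  exists (((gap t - n%:R) * w0 - n%:R * w1) / gap t ^+ 2,
          ((gap t + n%:R) * w1 + n%:R * w0) / gap t ^+ 2).
  by split=> [/eqP|/eqP|_ _|_ _]; rewrite ?t0 ?tk // /block0 /block1 /=; field.
have [->|t0] := eqVneq t 0%N.
  (* The single unknown is fixed by the output that is not selected. *)
  exists (if choice_at 0 then w0 / (k.+2%:R + n%:R) else - (w1 / n%:R), 0).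
  split=> // _; rewrite /block0 /block1 gap0; case: choice_at => //= _.
    by rewrite mulr0 addr0 mulrC divfK.
  by rewrite mulr0 add0r mulrN opprK mulrC divfK.
have [->|tk] := eqVneq t k.+2.
  exists (0, if choice_at k.+2 then w0 / n%:R else w1 / (- k.+2%:R - n%:R)).
  split=> // _; rewrite /block0 /block1 gap_max; case: choice_at => //= _.
    by rewrite mulr0 add0r mulrC divfK.
  by rewrite mulr0 subr0 mulrC divfK.
have gap_t : gap t = 0.
  by apply/eqP; rewrite gap_eq0; move: spec; rewrite /special (negPf t0) (negPf tk).
(* Only x + y matters at the centre, so [y] may be taken to be zero. *)
exists (if choice_at t then w0 / n%:R else - (w1 / n%:R), 0).
split=> // [/eqP|_|_]; first by rewrite (negPf tk).
  rewrite /block0 /block1 gap_t; case: choice_at => //= _.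
  by rewrite mulr0 addr0 add0r mulrC divfK.
rewrite /block0 /block1 gap_t; case: choice_at => //= _.
by rewrite mulr0 add0r mulrN opprK mulrC divfK.
Qed.

End LocalBlocks.

(** * Block form of the homological operator *)

Section HomologicalEntries.
Local Open Scope ring_scope.
Variables (K : numFieldType) (n k : nat).

Lemma monB0 p q : (mon p q - U_(ord0))%MM = mon p.-1 q.
Proof. by rewrite [LHS]mon_eta !mnmBE !mnm1E /= subn0 subn1. Qed.

Lemma monB1 p q : (mon p q - U_(1))%MM = mon p q.-1.
Proof. by rewrite [LHS]mon_eta !mnmBE !mnm1E /= subn0 subn1. Qed.

Lemma vp_actE (P : vpoly K) f : vp_act P f = P ord0 * f^`M(ord0) + P 1 * f^`M(1).
Proof.
rewrite /vp_act big_ord_recl big_ord1.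
by rewrite (_ : lift ord0 ord0 = 1) //; apply: val_inj.
Qed.

Lemma unperturbed0 : unperturbed K n.+1 ord0 = - 'X_[mon n.+1 n].
Proof. by rewrite /unperturbed eqxx subn1. Qed.

Lemma unperturbed1 : unperturbed K n.+1 1 = 'X_[mon n n.+1].
Proof. by rewrite /unperturbed /= subn1. Qed.

(** The unperturbed field is (x1 x2)^n times the linear field (-x1, x2), which has every monomial as
    an eigenvector, with eigenvalue q - p. *)
Lemma vp_act_unperturbed p q :
  vp_act (unperturbed K n.+1) 'X_[mon p q] = (q%:R - p%:R) *: 'X_[mon (p + n) (q + n)].
Proof.
rewrite vp_actE unperturbed0 unperturbed1 !mderivX monB0 monB1 mon0 mon1.
rewrite mulNr -!scalerAr -!mpolyXD !addm_mon scalerBl addrC; congr (_ - _).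
  case: q => [|q]; rewrite ?scale0r //; congr (_ *: 'X_[mon _ _]); lia.
case: p => [|p]; rewrite ?scale0r //; congr (_ *: 'X_[mon _ _]); lia.
Qed.

(** For n = 0 the truncated exponent [n.-1] is harmless, since its term has coefficient zero. *)
Lemma vp_act_unperturbed_comp0 (P : vpoly K) :
  vp_act P (unperturbed K n.+1 ord0)
    = - (n.+1%:R *: (P ord0 * 'X_[mon n n]) + n%:R *: (P 1 * 'X_[mon n.+1 n.-1])).
Proof.
rewrite vp_actE unperturbed0 !mderivN !mderivX monB0 monB1 mon0 mon1.
by rewrite !mulrN -!scalerAr opprD.
Qed.

Lemma vp_act_unperturbed_comp1 (P : vpoly K) :
  vp_act P (unperturbed K n.+1 1)
    = n%:R *: (P ord0 * 'X_[mon n.-1 n.+1]) + n.+1%:R *: (P 1 * 'X_[mon n n]).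
Proof.
rewrite vp_actE unperturbed1 !mderivX monB0 monB1 mon0 mon1.
by rewrite -!scalerAr.
Qed.

Lemma vp_act_sum (P : vpoly K) (I : finType) (F : I -> {mpoly K[2]}) :
  vp_act P (\sum_i F i) = \sum_i vp_act P (F i).
Proof. exact: (big_morph _ (vp_actD P) (vp_act0 P)). Qed.

Lemma vp_actZ (P : vpoly K) c f : vp_act P (c *: f) = c *: vp_act P f.
Proof. by rewrite -[c *: f]addr0 vp_actZD vp_act0 addr0. Qed.

Lemma chiS : chi n.+1 = (n + n)%N.
Proof. by rewrite /chi; lia. Qed.

(* [coefy] is shifted by one, so that [coefx Q t] and [coefy Q t] belong to the
   same block; both are zero out of range. *)
Definition coefx (Q : 'M[K]_(2, k.+2)) t := \sum_p Q ord0 p * (p == t :> nat)%:R.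
Definition coefy (Q : 'M[K]_(2, k.+2)) t := \sum_p Q 1 p * (p.+1 == t)%:R.

Lemma coefx_max Q t : (k.+2 <= t)%N -> coefx Q t = 0.
Proof.
move=> le_t; rewrite /coefx big1 // => p _.
by rewrite (ltn_eqF (leq_trans (ltn_ord p) le_t)) mulr0.
Qed.

Lemma coefy_max Q t : (k.+2 < t)%N -> coefy Q t = 0.
Proof.
move=> le_t; rewrite /coefy big1 // => p _.
by rewrite (ltn_eqF (leq_ltn_trans (ltn_ord p) le_t)) mulr0.
Qed.

Lemma coefy0 Q t : t = 0%N -> coefy Q t = 0.
Proof. by move=> ->; rewrite /coefy big1 // => p _; rewrite mulr0. Qed.

Lemma coefxE Q (p : 'I_k.+2) : coefx Q p = Q ord0 p.
Proof.
rewrite /coefx (bigD1 p) //= eqxx mulr1 big1 ?addr0 // => j /negPf jp.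
by rewrite -[_ == _ :> nat]/(j == p) jp mulr0.
Qed.

Lemma coefyE Q (p : 'I_k.+2) : coefy Q p.+1 = Q 1 p.
Proof.
rewrite /coefy (bigD1 p) //= eqxx mulr1 big1 ?addr0 // => j /negPf jp.
by rewrite eqSS -[_ == _ :> nat]/(j == p) jp mulr0.
Qed.

Lemma homological_row0 (Q : 'M[K]_(2, k.+2)) (u : 'I_(k + chi n.+1).+2) :
  homological n.+1 Q ord0 u =
    \sum_p Q ord0 p * (gap K k p + n%:R) * (p + n == u)%N%:R
    + n%:R * \sum_p Q 1 p * (p.+1 + n == u)%N%:R.
Proof.
rewrite mxE /lie vp_act_unperturbed_comp0 opprK vp_act_sum.
rewrite !mulr_suml mcoeffD mcoeffD !mcoeffZ !raddf_sum /=.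
have ltu := ltn_ord u; have chiE := chiS.
rewrite !mulr_sumr addrA -big_split /=; congr (_ + _); apply: eq_bigr => p _.
  have ltp := ltn_ord p.
  rewrite vp_actZ vp_act_unperturbed -scalerAl -mpolyXD addm_mon !mcoeffZ.
  rewrite mcoeff_mon; last lia.
  (* The eigenvalue k + 1 - 2p and the n + 1 from differentiating the unperturbed field add up to
     the gap plus n. *)
  rewrite /gap [(k.+1 - p)%:R]natrB // mul2n -addnn natrD -!natr1.
  ring.
(* The degree count needs n > 0 because of [n.-1]; otherwise the factor n removes the term. *)
have [n0|n0] := eqVneq n 0%N; first by rewrite (_ : n%:R = 0) ?mul0r // n0.
have ltp := ltn_ord p.
rewrite -scalerAl -mpolyXD addm_mon mcoeffZ mcoeff_mon; last lia.
by rewrite addnS -addSn.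
Qed.

Lemma homological_row1 (Q : 'M[K]_(2, k.+2)) (u : 'I_(k + chi n.+1).+2) :
  homological n.+1 Q 1 u =
    \sum_p Q 1 p * (gap K k p.+1 - n%:R) * (p + n == u)%N%:R
    - n%:R * \sum_p Q ord0 p * (p + n == u.+1)%N%:R.
Proof.
rewrite mxE /lie vp_act_unperturbed_comp1 vp_act_sum.
rewrite !mulr_suml mcoeffB mcoeffD !mcoeffZ !raddf_sum /=.
have ltu := ltn_ord u; have chiE := chiS.
rewrite !mulr_sumr opprD addrCA addrC -sumrB; congr (_ - _); apply: eq_bigr => p _.
  have ltp := ltn_ord p.
  rewrite vp_actZ vp_act_unperturbed -scalerAl -mpolyXD addm_mon !mcoeffZ.
  rewrite mcoeff_mon; last lia.
  rewrite /gap [(k.+1 - p)%:R]natrB // mul2n -addnn natrD -!natr1.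
  ring.
have [n0|n0] := eqVneq n 0%N; first by rewrite (_ : n%:R = 0) ?mul0r // n0.
have ltp := ltn_ord p.
rewrite -scalerAl -mpolyXD addm_mon mcoeffZ mcoeff_mon; last lia.
congr (_ * (_ * _%:R)); congr nat_of_bool; apply/eqP/eqP; lia.
Qed.

Lemma homological_entry0 (Q : 'M[K]_(2, k.+2)) (u : 'I_(k + chi n.+1).+2) t :
  (t + n = u)%N -> homological n.+1 Q ord0 u = block0 n k t (coefx Q t) (coefy Q t).
Proof.
move=> def_u; rewrite homological_row0 /block0 /coefx /coefy -def_u [in RHS]mulr_sumr.
congr (_ + _ * _); apply: eq_bigr => p _; rewrite eqn_add2r //.
by case: eqP => [->|_]; rewrite ?mulr0 // mulr1 mulrC mulr1.
Qed.

Lemma homological_entry1 (Q : 'M[K]_(2, k.+2)) (u : 'I_(k + chi n.+1).+2) t :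
  (t + n = u.+1)%N -> homological n.+1 Q 1 u = block1 n k t (coefx Q t) (coefy Q t).
Proof.
move=> def_u; rewrite homological_row1 /block1 /coefx /coefy -def_u [in RHS]mulr_sumr.
congr (_ - _ * _); apply: eq_bigr => p _; rewrite ?eqn_add2r //.
rewrite -eqSS -def_u -addSn eqn_add2r.
by case: eqP => [->|_]; rewrite ?mulr0 // mulr1 mulrC mulr1.
Qed.

Lemma homological_eq0_entry0 (Q : 'M[K]_(2, k.+2)) (u : 'I_(k + chi n.+1).+2) :
  (u < n)%N -> homological n.+1 Q ord0 u = 0.
Proof.
move=> lt_un; rewrite homological_row0 !big1 ?mulr0 ?addr0 // => p _.
  by rewrite gtn_eqF ?mulr0 //; lia.
by rewrite gtn_eqF ?mulr0 //; lia.
Qed.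

Lemma homological_eq0_entry1 (Q : 'M[K]_(2, k.+2)) (u : 'I_(k + chi n.+1).+2) :
  (u.+1 < n)%N -> homological n.+1 Q 1 u = 0.
Proof.
move=> lt_un; rewrite homological_row1 !big1 ?mulr0 ?subr0 // => p _.
  by rewrite gtn_eqF ?mulr0 //; lia.
by rewrite gtn_eqF ?mulr0 //; lia.
Qed.

End HomologicalEntries.

(** * The GNF positions span a complement of the image *)

Section HomologicalImage.
Local Open Scope ring_scope.
Variables (K : numFieldType) (n k : nat) (c1 c2 c3 : nat -> 'I_2).
Hypothesis k_gt0 : (0 < k)%N.

Definition selected (i : 'I_2) (u : 'I_(k + chi n.+1).+2) :=
  gnf_positionb n.+1 c1 c2 c3 i u ((k + chi n.+1).+1 - u).

Lemma selected0 (u : 'I_(k + chi n.+1).+2) t :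
  (t + n = u)%N -> selected ord0 u = sel0 n k c1 c2 c3 t.
Proof.
move=> def_u; have chiE := chiS n; rewrite /selected /sel0 def_u.
by congr gnf_positionb; lia.
Qed.

Lemma selected1 (u : 'I_(k + chi n.+1).+2) t :
  (t + n = u.+1)%N -> selected 1 u = sel1 n k c1 c2 c3 t.
Proof.
move=> def_u; have chiE := chiS n; rewrite /selected /sel1 def_u.
by congr gnf_positionb; lia.
Qed.

(** The claim splits over the blocks, where it is [block_indep]; entries outside all blocks are
    never reached by the operator. *)
Lemma homological_indep (Q : 'M[K]_(2, k.+2)) :
  (forall i u, ~~ selected i u -> homological n.+1 Q i u = 0) -> homological n.+1 Q = 0.
Proof.
move=> hQ; have chiE := chiS n.
have block t : (t <= k.+2)%N ->
    ((t <= k + n + 1)%N -> block0 n k t (coefx Q t) (coefy Q t) = 0)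
    /\ ((0 < t + n)%N -> block1 n k t (coefx Q t) (coefy Q t) = 0).
  move=> le_t; apply: (@block_indep K n k c1 c2 c3) => //.
  - by move=> ->; apply: coefx_max.
  - by move=> ->; apply: coefy0.
  - move=> le_tn; have lt_u : (t + n < (k + chi n.+1).+2)%N by lia.
    rewrite -(@selected0 (Ordinal lt_u)) // => /hQ.
    by rewrite (@homological_entry0 _ _ _ _ _ t).
  - move=> le_tn; have lt_u : ((t + n).-1 < (k + chi n.+1).+2)%N by lia.
    have e : (t + n = (Ordinal lt_u).+1)%N by rewrite /= prednK.
    rewrite -(selected1 e) => /hQ.
    by rewrite (homological_entry1 _ e).
apply/matrixP => i u; rewrite [RHS]mxE; have ltu := ltn_ord u; elim/ord2_ind: i.
  have [lt_un|le_nu] := ltnP u n; first exact: homological_eq0_entry0.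
  rewrite (@homological_entry0 _ _ _ _ _ (u - n)) ?subnK //.
  have [le_t|lt_t] := leqP (u - n) k.+2; first by apply: (block _ le_t).1; lia.
  by rewrite coefx_max ?coefy_max /block0 ?mulr0 ?addr0 // ltnW.
have [lt_un|le_nu] := ltnP u.+1 n; first exact: homological_eq0_entry1.
rewrite (@homological_entry1 _ _ _ _ _ (u.+1 - n)) ?subnK //.
have [le_t|lt_t] := leqP (u.+1 - n) k.+2; first by apply: (block _ le_t).2; lia.
by rewrite coefx_max ?coefy_max /block1 ?mulr0 ?subr0 // ltnW.
Qed.

Lemma homological_span (W : 'M[K]_(2, (k + chi n.+1).+2)) :
  exists Q : 'M[K]_(2, k.+2),
    forall i u, ~~ selected i u -> W i u = homological n.+1 Q i u.
Proof.
have chiE := chiS n.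
(* Where an index is out of range or truncated, the value is a default that the side conditions of
   [block_solve] never use. *)
pose w0 t := W ord0 (inord (t + n)); pose w1 t := W 1 (inord (t + n).-1).
have /fin_all_exists[xy xyP] (t : 'I_k.+3) :=
  @block_solve K n k c1 c2 c3 k_gt0 t (w0 t) (w1 t) (ltn_ord t).
(* The shift to [p.+1] in the second row matches the convention of [coefy]. *)
pose Q : 'M[K]_(2, k.+2) := \matrix_(i, p)
  if i == ord0 then (xy (inord p)).1 else (xy (inord p.+1)).2.
have coefx_xy (t : 'I_k.+3) : coefx Q t = (xy t).1.
  have [_ _ _ _] := xyP t; have [lt_t|ge_t] := ltnP t k.+2.
    by rewrite (coefxE Q (Ordinal lt_t)) mxE eqxx /= inord_val.
  rewrite coefx_max //; case: (xyP t) => -> //.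
  by have := ltn_ord t; lia.
have coefy_xy (t : 'I_k.+3) : coefy Q t = (xy t).2.
  case: (posnP t) => [t0|t0]; first by rewrite coefy0 //; case: (xyP t) => _ ->.
  have lt_t : (t.-1 < k.+2)%N by have := ltn_ord t; lia.
  have:= coefyE Q (Ordinal lt_t); rewrite mxE /= prednK // => ->.
  by rewrite inord_val.
exists Q => i u; have ltu := ltn_ord u; elim/ord2_ind: i.
  (* Monomials outside all blocks are low or high GNF positions, so nothing is demanded of them. *)
  have [lt_un|le_nu] := ltnP u n.
    by rewrite /selected /gnf_positionb /= addn2 !ltnS lt_un.
  have [le_t|lt_t] := leqP (u - n) k.+2; last first.
    by rewrite /selected /gnf_positionb /= (_ : (_ + 3 <= _)%N) ?orbT //; lia.
  have lt_t : (u - n < k.+3)%N by [].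
  have e : (Ordinal lt_t + n = u)%N by rewrite subnK.
  rewrite (selected0 e) (homological_entry0 _ e) coefx_xy coefy_xy.
  have [_ _ h _] := xyP (Ordinal lt_t).
  by move/h => <-; [rewrite /w0 e inord_val|rewrite /=; lia].
have [lt_un|le_nu] := ltnP u.+1 n.
  by rewrite /selected /gnf_positionb /= (_ : (_ + 3 <= _)%N) //; lia.
have [le_t|lt_t] := leqP (u.+1 - n) k.+2; last first.
  by rewrite /selected /gnf_positionb /= (_ : ((_ - _) + 2 <= _)%N) ?orbT //; lia.
have lt_t : (u.+1 - n < k.+3)%N by [].
have e : (Ordinal lt_t + n = u.+1)%N by rewrite subnK.
rewrite (selected1 e) (homological_entry1 _ e) coefx_xy coefy_xy.
have [_ _ _ h] := xyP (Ordinal lt_t).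
by move/h => <-; [rewrite /w1 e inord_val|rewrite e].
Qed.

End HomologicalImage.

(** * Linearity of the homological operator *)

Section HomologicalLinear.
Local Open Scope ring_scope.
Variables (K : numFieldType) (n k : nat).

Lemma of_coefsZD d c (M1 M2 : 'M[K]_(2, d.+2)) i :
  of_coefs (c *: M1 + M2) i = c *: of_coefs M1 i + of_coefs M2 i.
Proof.
rewrite /of_coefs scaler_sumr -big_split; apply: eq_bigr => p _ /=.
by rewrite !mxE scalerDl scalerA.
Qed.

(** [lin_mx] evaluates its argument on unit matrices only; linearity makes its row space the image,
    so that the rank in [nres] is the dimension of that image. *)
Lemma homological_is_linear : linear (@homological K n.+1 k).
Proof.
move=> c Q1 Q2; apply/matrixP => i u.
rewrite [LHS]mxE [RHS]mxE [in RHS]mxE ![coefs _ _ _ _]mxE -mcoeffZ -mcoeffD.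
congr (_@_ _); rewrite /lie of_coefsZD vp_actZD scalerBr [RHS]addrACA -opprD.
congr (_ - _); rewrite !vp_actE !of_coefsZD scalerDr !scalerAl [RHS]addrACA.
by rewrite -!mulrDl.
Qed.

HB.instance Definition _ := GRing.isLinear.Build K _ _ _ (@homological K n.+1 k)
  homological_is_linear.

Lemma sub_homological (w : 'rV[K]_(2 * (k + chi n.+1).+2)) :
  reflect (exists Q, mxvec (@homological K n.+1 k Q) = w)
          (w <= lin_mx (@homological K n.+1 k))%MS.
Proof.
apply: (iffP submxP) => [[D ->]|[Q <-]].
  by exists (vec_mx D); rewrite -mul_vec_lin vec_mxK.
by exists (mxvec Q); rewrite mul_vec_lin.
Qed.

End HomologicalLinear.

(** * The GNF positions form a resonant set *)

Section ResonantSet.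
Local Open Scope ring_scope.
Variables (K : numFieldType) (n : nat) (c1 c2 c3 : nat -> 'I_2).

Lemma gnf_position_mdeg i a : gnf_position n.+1 c1 c2 c3 i a -> ((chi n.+1).+1 < mdeg a)%N.
Proof.
have chiE := chiS n; case=> *; rewrite mdeg_mon; lia.
Qed.

Lemma mxvec_index_inj d e (x y : 'I_d * 'I_e) :
  mxvec_index x.1 x.2 = mxvec_index y.1 y.2 -> x = y.
Proof.
by case: x y => [x1 x2] [y1 y2] /cast_ord_inj /enum_rank_inj.
Qed.

Lemma gnf_resonant_set : resonant_set K n.+1 (gnf_position n.+1 c1 c2 c3).
Proof.
split=> [i a|k k_gt0]; first exact: gnf_position_mdeg.
pose T := [set x : 'I_2 * 'I_(k + chi n.+1).+2 | selected c1 c2 c3 x.1 x.2].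
pose l (j : 'I_#|T|) := enum_val j.
pose H := lin_mx (@homological K n.+1 k).
pose col j := mxvec_index (l j).1 (l j).2.
have col_inj : injective col by move=> i j /mxvec_index_inj /enum_val_inj.
have colP (x : 'I_2 * 'I_(k + chi n.+1).+2) : ~~ selected c1 c2 c3 x.1 x.2 ->
    forall j, col j != mxvec_index x.1 x.2.
  move=> nx j; apply/eqP => /mxvec_index_inj lj; case/negP: nx.
  by rewrite -lj; have:= enum_valP j; rewrite inE.
have H_indep w : (w <= H)%MS -> supported col w -> w = 0.
  move=> /sub_homological[Q <-] sQ; rewrite (@homological_indep _ n k c1 c2 c3) ?linear0 //.
  by move=> i u nsel; rewrite -mxvecE sQ // => j; apply: (colP (i, u)).
have H_span w : exists2 u, (u <= H)%MS & supported col (w - u).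
  have [Q hQ] := @homological_span K n k c1 c2 c3 k_gt0 (vec_mx w).
  exists (mxvec (homological n.+1 Q)); first by apply/sub_homological; exists Q.
  move=> j; case/mxvec_indexP: j => i u nl; rewrite !mxE mxvecE.
  have [sel|/hQ <-] := boolP (selected c1 c2 c3 i u); last by rewrite mxE subrr.
  have xT : (i, u) \in T by rewrite inE.
  by have:= nl (enum_rank_in xT (i, u)); rewrite /col /l enum_rankK_in // eqxx.
have rkE := complement_rank col_inj H_indep H_span.
have [A [Afree HA detA]] := complement_equations col_inj H_indep H_span.
have selE (i : 'I_2) (p : 'I_(k + chi n.+1).+2) :
    gnf_position n.+1 c1 c2 c3 i (mon p ((k + chi n.+1).+1 - p)) <-> exists j, l j = (i, p).
  have ltp := ltn_ord p; have chiE := chiS n.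
  have le_p : (2 * n.+1 <= p + ((k + chi n.+1).+1 - p))%N by lia.
  split=> [/(gnf_positionP _ _ _ _ (ltn0Sn n) le_p) sel|[j lj]].
    have xT : (i, p) \in T by rewrite inE.
    by exists (enum_rank_in xT (i, p)); rewrite /l enum_rankK_in.
  apply/gnf_positionP => //.
  by have:= enum_valP j; rewrite inE -/(l j) lj.
(* A matrix with nonzero determinant has no zero column, so each selected coefficient participates
   in some equation. *)
have A_col j : exists i, A i (col j) != 0.
  apply/existsP; apply: contraT; rewrite negb_exists => /forallP Aj0.
  rewrite (expand_det_col _ j) big1 ?eqxx // in detA => i _.
  by have:= Aj0 i; rewrite mxE negbK => /eqP->; rewrite mul0r.
have HA' : forall W : 'M[K]_(2, (k + chi n.+1).+2),
    (exists Q : 'M[K]_(2, k.+2), homological n.+1 Q = W) <-> A *m (mxvec W)^T = 0.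
  move=> W; rewrite -HA; split=> [[Q <-]|/sub_homological[Q /(can_inj mxvecK)]].
    by apply/sub_homological; exists Q.
  by exists Q.
(* [nres] occurs in the types of the witnesses; the complement dimension identifies it with the
   number of selected positions. *)
rewrite /resonance_equations (_ : nres K n.+1 k = #|T|); last exact: esym rkE.
by exists A, l; split.
Qed.

End ResonantSet.

(** * Coefficients of series operations through polynomial truncations *)

Section Truncation.
Local Open Scope ring_scope.
Variable K : fieldType.
Implicit Types (f : fseries K) (V g : vseries K).

Lemma mcoeff_trunc d f a : (trunc d f)@_a = if (mdeg a <= d)%N then f a else 0.
Proof.
rewrite /trunc; case: leqP => le_ad; first by rewrite mcoeff_mpoly.
rewrite raddf_sum big1 //= => b _; rewrite mcoeffZ mcoeffX.
by case: eqP => [eq_ba|_]; rewrite ?mulr0 //; have := bmdeg b; rewrite eq_ba ltnNge le_ad.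
Qed.

Lemma eq_trunc d f f' : (forall a, (mdeg a <= d)%N -> f a = f' a) -> trunc d f = trunc d f'.
Proof. by move=> eq_f; apply/mpolyP => a; rewrite !mcoeff_trunc; case: ifP => // /eq_f. Qed.

Lemma mord_trunc r d f (p : {mpoly K[2]}) : (r <= d.+1)%N ->
  (forall a, (mdeg a < r)%N -> f a = p@_a) -> mord r (trunc d f - p).
Proof.
move=> le_rd eq_fp a lt_ar; rewrite mcoeffB mcoeff_trunc eq_fp // ifT ?subrr //.
by rewrite -ltnS; apply: leq_trans le_rd.
Qed.

Lemma mcoeff_eq_mord d (p q : {mpoly K[2]}) a :
  mord d.+1 (p - q) -> (mdeg a <= d)%N -> p@_a = q@_a.
Proof. by move=> dpq le_ad; apply/eqP; rewrite -subr_eq0 -mcoeffB dpq. Qed.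

(** Higher terms cannot reach the coefficient at [a], so one bound [N] serves all coefficients up to
    degree [N]. Differentiation costs one degree, hence [N.+1] for [f]. *)
Lemma fs_actE N V f a : (mdeg a <= N)%N ->
  fs_act V f a = (vp_act (fun j => trunc N (V j)) (trunc N.+1 f))@_a.
Proof.
move=> le_aN; rewrite /fs_act.
have dV j : mord (mdeg a).+1 (trunc N (V j) - trunc (mdeg a) (V j)).
  by apply: mord_trunc => [|b lt_b]; rewrite ?ltnS // mcoeff_trunc -ltnS lt_b.
have df : mord (mdeg a).+2 (trunc N.+1 f - trunc (mdeg a).+1 f).
  by apply: mord_trunc => [|b lt_b]; rewrite ?ltnS // mcoeff_trunc -ltnS lt_b.
apply/esym/(@mcoeff_eq_mord (mdeg a)) => //; rewrite -[X in vp_act _ X](subrK (trunc (mdeg a).+1 f)).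
rewrite vp_actD -addrA -vp_actBl; apply: mordD.
  by apply: mordW (mord_vp_act _ df); [|move=> j; apply: mordn0].
by apply: mordW (mord_vp_act dV (@mordn0 _ _ _)); rewrite addn0.
Qed.

(** Without constant terms in [g], the terms of [f] of high degree cannot contribute in low
    degree. *)
Lemma fs_substE N f g a : (mdeg a <= N)%N -> (forall i, mord 1 (trunc N (g i))) ->
  fs_subst f g a = (vcomp (trunc N f) (fun i => trunc N (g i)))@_a.
Proof.
move=> le_aN dg; rewrite /fs_subst -/(vcomp _ (fun i => trunc (mdeg a) (g i))).
have trunc_close (h : fseries K) : mord (mdeg a).+1 (trunc N h - trunc (mdeg a) h).
  by apply: mord_trunc => [|b lt_b]; rewrite ?ltnS // mcoeff_trunc -ltnS lt_b.
apply/esym/(@mcoeff_eq_mord (mdeg a)) => //.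
rewrite -[X in mord _ X](subrKA (vcomp (trunc (mdeg a) f) (fun i => trunc N (g i)))).
rewrite -vcompB; apply: mordD; last by apply: vcomp_congr.
by apply: mord_vcomp.
Qed.

Lemma truncD d f (p : {mpoly K[2]}) : (forall a, (d < mdeg a)%N -> p@_a = 0) ->
  trunc d (fun a => f a + p@_a) = trunc d f + p.
Proof.
move=> dp; apply/mpolyP => a; rewrite mcoeffD !mcoeff_trunc.
by case: leqP => // /dp ->; rewrite addr0.
Qed.

Lemma mcoeff_of_coefs k (M : 'M[K]_(2, k.+2)) i a :
  (of_coefs M i)@_a = if mdeg a == k.+1 then M i (inord (a ord0)) else 0.
Proof.
rewrite /of_coefs raddf_sum /= (mon_eta a) mdeg_mon mon0.
case: eqP => [deg_a|deg_a].
  have lt_a : (a ord0 < k.+2)%N by lia.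
  rewrite (bigD1 (inord (a ord0))) //= mcoeffZ mcoeff_mon inordK //; last lia.
  rewrite eqxx mulr1 big1 ?addr0 // => p ne_p.
  have ltp := ltn_ord p.
  rewrite mcoeffZ mcoeff_mon; last lia.
  case: eqP => [eq_p|_]; last by rewrite mulr0.
  by case/eqP: ne_p; apply: val_inj; rewrite /= inordK.
rewrite big1 // => p _; have ltp := ltn_ord p.
rewrite mcoeffZ mcoeffX eq_mon; case: andP; rewrite ?mulr0 // => -[/eqP e1 /eqP e2]; lia.
Qed.

Lemma mord_of_coefs k (M : 'M[K]_(2, k.+2)) i : mord k.+1 (of_coefs M i).
Proof. by move=> a lt_a; rewrite mcoeff_of_coefs ltn_eqF. Qed.

End Truncation.

(** * One normalization step, the recursion and its formal limit *)

Lemma addr_regroup (V : zmodType) (p p' q q' r s : V) :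
  (p + q + (p' + q') - (p + (r + s)) = (p' - r) + (q - s) + q')%R.
Proof.
rewrite -(addrA p) opprD addrACA subrr add0r addrA addrAC; congr (_ + _)%R.
by rewrite (addrC q) opprD addrACA.
Qed.

Lemma eq_vp_act (K : fieldType) (P Q : vpoly K) f : P =1 Q -> vp_act P f = vp_act Q f.
Proof. by move=> eqPQ; apply: eq_bigr => j _; rewrite eqPQ. Qed.

Lemma eq_vcomp (K : fieldType) (g g' : vpoly K) f : g =1 g' -> vcomp f g = vcomp f g'.
Proof. by move=> eqg; congr comp_mpoly; apply: eq_mktuple. Qed.

Section NormalizationStep.
Local Open Scope ring_scope.
Variables (K : numFieldType) (n : nat) (c1 c2 c3 : nat -> 'I_2) (X : vseries K).
Local Notation H := (unperturbed K n.+1).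
Local Notation ch := (chi n.+1).

(** The conjugacy equation at one coefficient, so that it can be established degree by degree. *)
Definition normalized_at (Q Y : vseries K) i a :=
  fs_act (vs_add (vseries_of H) Y) (near_id Q i) a
  = fs_subst (vs_add (vseries_of H) X i) (near_id Q) a.

Definition gnf_supported (Y : vseries K) :=
  forall i (a : 'X_{1..2}), ~~ gnf_positionb n.+1 c1 c2 c3 i (a ord0) (a 1) -> Y i a = 0.

Hypothesis hX : ord_ge ch.+1 X.

Lemma mord_unperturbed i : mord ch.+1 (H i).
Proof.
have chiE := chiS n; elim/ord2_ind: i; rewrite ?unperturbed0 ?unperturbed1 ?chiE.
  apply: mordN; have:= @mordX K _ (mon n.+1 n); apply: mordW.
  by rewrite mdeg_mon addSn.
have:= @mordX K _ (mon n n.+1); apply: mordW.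
by rewrite mdeg_mon addnS.
Qed.

Lemma ord_ge_eq0 (V : vseries K) d i a : ord_ge d V -> (mdeg a <= d)%N -> V i a = 0.
Proof. by move=> dV le_ad; apply/eqP; apply: contraTT le_ad => /dV; rewrite -ltnNge. Qed.

(** The defect of the conjugacy equation; its lowest part is the known term of the homological
    equation. *)
Definition residual d (Q Y : vseries K) : vpoly K := fun i =>
  vcomp (trunc d (vs_add (vseries_of H) X i)) (fun j => trunc d (near_id Q j))
  - vp_act (fun j => trunc d (vs_add (vseries_of H) Y j)) (trunc d.+1 (near_id Q i)).

(** Corrections [h] of degree k + 1 and [y] of degree k + chi + 1 change the defect, up to degree k
    + chi + 1, by exactly -([H, h] + y). It is cancelled by y = W - [H, h], which lies in GNF
    positions by the choice of [M]. *)
Lemma normalization_step k Q Y (M : 'M[K]_(2, k.+2)) :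
    ord_ge 1 Q -> ord_ge ch.+1 Y ->
    (forall i a, (mdeg a < (k + ch).+1)%N -> normalized_at Q Y i a) ->
  let W := coefs (k + ch) (residual (k + ch).+1 Q Y) in
  let L := W - homological n.+1 M in
  (0 < k)%N -> (forall i u, ~~ selected c1 c2 c3 i u -> W i u = homological n.+1 M i u) ->
  gnf_supported (vseries_of (of_coefs L)) /\
  forall i a, (mdeg a < (k + ch).+2)%N ->
    normalized_at (vs_add Q (vseries_of (of_coefs M)))
                  (vs_add Y (vseries_of (of_coefs L))) i a.
Proof.
move=> dQ dY hQY W L k0 hM; have chiE := chiS n; set N := (k + ch).+1.
pose P j := trunc N (vs_add (vseries_of H) Y j).
pose F i := trunc N (vs_add (vseries_of H) X i).
pose g i := trunc N.+1 (near_id Q i).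
pose g' i := trunc N (near_id Q i).
have dP j : mord ch.+2 (P j - H j).
  apply: mord_trunc => [|a lt_a]; first by rewrite /N; lia.
  by rewrite /vs_add (ord_ge_eq0 j dY) ?addr0.
have dF j : mord ch.+2 (F j - H j).
  apply: mord_trunc => [|a lt_a]; first by rewrite /N; lia.
  by rewrite /vs_add (ord_ge_eq0 j hX) ?addr0.
have dg i : mord 2 (g i - 'X_i).
  apply: mord_trunc => [|a lt_a] //.
  by rewrite /near_id /vs_add (ord_ge_eq0 i dQ) ?addr0.
have dg' i : mord 2 (g' i - 'X_i).
  apply: mord_trunc => [|a lt_a] //.
  by rewrite /near_id /vs_add (ord_ge_eq0 i dQ) ?addr0.
pose R := residual N Q Y.
pose h := of_coefs M; pose y := of_coefs L.
have dh i : mord k.+1 (h i) := mord_of_coefs M i.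
have dy i : mord N (y i) := mord_of_coefs L i.
(* To this order [P] acts on [h] as the unperturbed field does, [y] acts on [g] as on the identity,
   and [y] acting on [h] is negligible. *)
have dE i : mord N.+1 (vp_act (fun j => P j + y j) (g i + h i)
                    - (vp_act P (g i) + (vp_act H (h i) + y i))).
  rewrite vp_actD !vp_actDl.
  rewrite addr_regroup -vp_actBl -[y i in X in mord _ X]vp_actXU -vp_actB.
  have d1 := mord_vp_act dP (dh i); have d2 := mord_vp_act dy (dg i).
  have d3 := mord_vp_act dy (dh i).
  by do !apply: mordD; [apply: mordW d1|apply: mordW d2|apply: mordW d3]; rewrite /N; lia.
(* Taylor expansion of the substitution, followed by replacing [F] with its leading part in the
   linear term. *)
have dE' i : mord N.+1 (vcomp (F i) (fun j => g' j + h j)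
                       - (vcomp (F i) g' + vp_act h (H i))).
  have dFi : mord ch.+1 (F i).
    rewrite -[F i](subrK (H i)); apply: mordD (mord_unperturbed i).
    exact: mordW (dF i).
  have := vcomp_taylor k0 dg' dh dFi; have := mord_vp_act dh (dF i).
  rewrite vp_actB => d1 d2.
  rewrite opprD addrA -(subrKA (vp_act h (F i))).
  by apply: mordD; [apply: mordW d2|apply: mordW d1]; rewrite /N; lia.
have g'0 i : mord 1 (g' i).
  rewrite -[g' i](subrK 'X_i); apply: mordD; first exact: mordW (dg' i).
  by have := @mordX K _ U_(i)%MM; rewrite mdeg1.
have R0 i a : (mdeg a < N)%N -> (R i)@_a = 0.
  move=> lt_a; rewrite /R /residual mcoeffB; apply/eqP; rewrite subr_eq0 eq_sym; apply/eqP.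
  by have := hQY i a lt_a; rewrite /normalized_at (fs_actE _ _ (ltnW lt_a)) (fs_substE _ (ltnW lt_a)).
(* Below degree [N] both sides vanish; in degree [N] this is the definition of [L]. *)
have RE i a : (mdeg a <= N)%N -> (R i)@_a = (lie H h i + y i)@_a.
  rewrite leq_eqVlt => /orP[/eqP deg_a|lt_a]; last first.
    rewrite R0 // mcoeffD (dy i) // addr0 mcoeffB.
    have d1 : mord N (vp_act H (h i)).
      by apply: mordW (mord_vp_act mord_unperturbed (dh i)); rewrite /N; lia.
    have d2 : mord N (vp_act h (H i)).
      by apply: mordW (mord_vp_act dh (mord_unperturbed i)); rewrite /N; lia.
    by rewrite d1 // d2 // subrr.
  have lt_a0 : (a ord0 < N.+1)%N.
    by move: deg_a; rewrite {1}(mon_eta a) mdeg_mon; lia.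
  have def_a : a = mon (Ordinal lt_a0) (N - Ordinal lt_a0).
    rewrite [LHS]mon_eta; congr mon; move: deg_a; rewrite {1}(mon_eta a) mdeg_mon /=; lia.
  rewrite mcoeffD mcoeff_of_coefs deg_a eqxx !mxE.
  rewrite (_ : inord _ = Ordinal lt_a0); last by apply: val_inj; rewrite /= inordK.
  by rewrite -/N -def_a -/h addrCA subrr addr0.
split=> [i a|i a lt_a].
  rewrite /vseries_of mcoeff_of_coefs; case: eqP => // deg_a nsel.
  rewrite mxE hM; first by rewrite [X in _ + X]mxE subrr.
  apply: contra nsel.
  have lt_a0 : (a ord0 < N.+1)%N.
    by move: deg_a; rewrite {1}(mon_eta a) mdeg_mon /N; lia.
  rewrite /selected inordK //; congr gnf_positionb.
  by move: deg_a; rewrite {1}(mon_eta a) mdeg_mon; lia.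
have trunc_near l : (k < l)%N -> forall j : 'I_2,
    trunc l (near_id (vs_add Q (vseries_of h)) j) = trunc l (near_id Q j) + h j.
  move=> lt_kl j; rewrite -truncD => [|b lt_b]; last first.
    by rewrite mcoeff_of_coefs gtn_eqF //; apply: leq_ltn_trans lt_b.
  by apply: eq_trunc => b _; rewrite /near_id /vs_add addrA.
have trunc_Y j : trunc N (vs_add (vseries_of H) (vs_add Y (vseries_of y)) j) = P j + y j.
  rewrite -truncD => [|b lt_b]; last by rewrite mcoeff_of_coefs gtn_eqF.
  by apply: eq_trunc => b _; rewrite /vs_add addrA.
have kN : (k < N)%N by rewrite /N; lia.
rewrite /normalized_at (fs_actE _ _ lt_a) (fs_substE _ lt_a); last first.
  by move=> j; rewrite trunc_near //; apply: mordD (g'0 j) _; apply: mordW (dh j).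
rewrite (eq_vp_act _ trunc_Y) (eq_vcomp _ (trunc_near N kN)) trunc_near; last exact: ltnW.
rewrite (mcoeff_eq_mord (dE i) lt_a) (mcoeff_eq_mord (dE' i) lt_a).
move: (RE i a lt_a); rewrite /R /residual /lie !mcoeffD !mcoeffN => /(canRL (subrK _)) ->; ring.
Qed.

(** Boolean quantifiers make the predicate decidable, so [xchoose] can turn existence into a
    function usable in the recursion. *)
Lemma homological_solution_exists k (W : 'M[K]_(2, (k.+1 + ch).+2)) :
  exists M : 'M[K]_(2, k.+3), [forall i, forall u,
    ~~ selected c1 c2 c3 i u ==> (W i u == homological n.+1 M i u)].
Proof.
have [M hM] := homological_span c1 c2 c3 (ltn0Sn k) W; exists M.
by apply/forallP => i; apply/forallP => u; apply/implyP => /hM ->.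
Qed.

Definition homological_solution k (W : 'M[K]_(2, (k.+1 + ch).+2)) : 'M[K]_(2, k.+3) :=
  xchoose (homological_solution_exists W).

Lemma homological_solutionP k (W : 'M[K]_(2, (k.+1 + ch).+2)) i u :
  ~~ selected c1 c2 c3 i u -> W i u = homological n.+1 (homological_solution W) i u.
Proof.
move=> nsel; have /forallP/(_ i)/forallP/(_ u) := xchooseP (homological_solution_exists W).
by rewrite nsel => /eqP.
Qed.

(* Passing from [k] to [k.+1] adds a term of degree [k.+2] to the transformation
   and one of degree [(k.+1 + chi).+1] to the normal form, hence the limits below
   are reached at every monomial. *)
Fixpoint approx (k : nat) : vseries K * vseries K :=
  if k is l.+1 then
    let QY := approx l in
    let W := coefs (l.+1 + ch) (residual (l.+1 + ch).+1 QY.1 QY.2) in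
    let M := homological_solution W in
    (vs_add QY.1 (vseries_of (of_coefs M)),
     vs_add QY.2 (vseries_of (of_coefs (W - homological n.+1 M))))
  else (fun _ _ => 0, fun _ _ => 0).

Lemma trunc_vseries_of d (P : vpoly K) i : (forall a, (d < mdeg a)%N -> (P i)@_a = 0) ->
  trunc d (vseries_of P i) = P i.
Proof.
move=> dP; apply/mpolyP => a; rewrite mcoeff_trunc /vseries_of.
by case: leqP => // /dP.
Qed.

(** In these degrees the perturbation vanishes and the identity conjugates the unperturbed field to
    itself. *)
Lemma normalized_at0 i a : (mdeg a < ch.+2)%N ->
  normalized_at (fun _ _ => 0) (fun _ _ => 0) i a.
Proof.
move=> lt_a; have chiE := chiS n.
have tX d j : (0 < d)%N -> trunc d (near_id (fun _ _ => 0 : K) j) = 'X_j.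
  move=> d0; rewrite -[RHS](@trunc_vseries_of d (fun i => 'X_i)) => [|b lt_b].
    by apply: eq_trunc => b _; rewrite /near_id /vs_add addr0.
  by rewrite mcoeffX; case: eqP lt_b => // <-; rewrite mdeg1 ltnS leqNgt d0.
have tH j : trunc ch.+1 (vs_add (vseries_of H) (fun _ _ => 0) j) = H j.
  rewrite -[RHS](@trunc_vseries_of ch.+1 H) => [|b lt_b].
    by apply: eq_trunc => b _; rewrite /vs_add addr0.
  move: lt_b; rewrite chiE; elim/ord2_ind: j; rewrite ?unperturbed0 ?unperturbed1.
    rewrite mcoeffN mcoeffX; case: eqP => [<-|]; rewrite ?oppr0 // mdeg_mon; lia.
  rewrite mcoeffX; case: eqP => [<-|] //; rewrite mdeg_mon; lia.
have dX j : mord 1 ('X_j : {mpoly K[2]}).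
  by have := @mordX K _ U_(j)%MM; rewrite mdeg1.
rewrite /normalized_at (fs_actE _ _ (N := ch.+1)) // (fs_substE _ (N := ch.+1)) //; last first.
  by move=> j; rewrite tX.
rewrite tX // (eq_vp_act _ tH) vp_actXU (eq_vcomp _ (g' := fun j => 'X_j)); last first.
  by move=> j; rewrite tX.
by rewrite /vcomp comp_mpoly_id mcoeff_trunc -ltnS lt_a /vs_add (ord_ge_eq0 i hX) ?addr0.
Qed.

Lemma ord_geD d (V W : vseries K) : ord_ge d V -> ord_ge d W -> ord_ge d (vs_add V W).
Proof.
move=> dV dW i a; apply: contraR; rewrite -leqNgt => le_a.
by rewrite /vs_add (ord_ge_eq0 i dV) ?(ord_ge_eq0 i dW) ?addr0.
Qed.

Lemma ord_ge_of_coefs d k (M : 'M[K]_(2, k.+2)) : (d <= k)%N ->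
  ord_ge d (vseries_of (of_coefs M)).
Proof.
move=> le_dk i a; rewrite /vseries_of mcoeff_of_coefs.
by case: (mdeg a =P k.+1) => [->|]; rewrite ?eqxx.
Qed.

Lemma approxP k :
  [/\ ord_ge 1 (approx k).1, ord_ge ch.+1 (approx k).2, gnf_supported (approx k).2
    & forall i a, (mdeg a < (k.+1 + ch).+1)%N -> normalized_at (approx k).1 (approx k).2 i a].
Proof.
elim: k => [|k [dQ dY sY hQY]].
  split=> [i a|i a|//|i a lt_a]; rewrite ?eqxx //.
  exact: normalized_at0.
have [sL hL] := normalization_step dQ dY hQY (ltn0Sn k) (@homological_solutionP _ _).
split=> //=.
- by apply: ord_geD => //; apply: ord_ge_of_coefs.
- by apply: ord_geD => //; apply: ord_ge_of_coefs; rewrite addSn ltnS leq_addl.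
- by move=> i a nsel; rewrite /vs_add sY // sL // addr0.
Qed.

Lemma approx_stable i a k l : (mdeg a <= k)%N -> (k <= l)%N ->
  (approx l).1 i a = (approx k).1 i a /\ (approx l).2 i a = (approx k).2 i a.
Proof.
move=> le_ak /subnK <-; elim: (l - k)%N => [//|j [<- <-]].
by rewrite addSn /= /vs_add /vseries_of !mcoeff_of_coefs !ltn_eqF ?addr0 //; lia.
Qed.

(** By [approx_stable], a coefficient no longer changes once the index reaches its degree. *)
Definition limitQ : vseries K := fun i a => (approx (mdeg a)).1 i a.
Definition limitY : vseries K := fun i a => (approx (mdeg a)).2 i a.

Lemma limit_normalized i a : normalized_at limitQ limitY i a.
Proof.
(* One more than the degree of [a], since the action differentiates a truncation of that degree. *)
pose k := (mdeg a).+1.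
have QE j b : (mdeg b <= k)%N -> limitQ j b = (approx k).1 j b.
  by move=> le_b; case: (approx_stable j (leqnn _) le_b).
have YE j b : (mdeg b <= k)%N -> limitY j b = (approx k).2 j b.
  by move=> le_b; case: (approx_stable j (leqnn _) le_b).
have [_ _ _ /(_ i a)] := approxP k; rewrite /normalized_at /fs_act /fs_subst.
have trunc_eq (f f' : fseries K) d : (d <= k)%N ->
    (forall b, (mdeg b <= k)%N -> f b = f' b) -> trunc d f' = trunc d f.
  by move=> le_dk eq_f; apply: eq_trunc => b le_b; rewrite eq_f // (leq_trans le_b).
have near_eq j d : (d <= k)%N ->
    trunc d (near_id (approx k).1 j) = trunc d (near_id limitQ j).
  by move=> le_dk; apply: trunc_eq => // b le_b; rewrite /near_id /vs_add QE.
rewrite near_eq // (eq_vp_act _ (Q := fun j =>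
  trunc (mdeg a) (vs_add (vseries_of H) limitY j))); last first.
  by move=> j; apply: trunc_eq => // b le_b; rewrite /vs_add YE.
move=> ->; last by rewrite /k; lia.
congr (comp_mpoly _ _)@_a; apply: eq_mktuple => j; exact: near_eq.
Qed.

End NormalizationStep.

(** * Existence of the normalizing transformation *)

Theorem corollary3 (K : numFieldType) (m : nat) (hm : (1 <= m)%N)
    (c1 c2 c3 : nat -> 'I_2)
    (X : vseries K) (hX : ord_ge (chi m).+1 X) :
  exists Q Y : vseries K,
    [/\ ord_ge 1 Q,
        is_gnf m (gnf_position m c1 c2 c3) Y
      & transforms Q (vs_add (vseries_of (unperturbed K m)) X)
                     (vs_add (vseries_of (unperturbed K m)) Y)].
Proof.
case: m hm hX => // n _ hX.
exists (limitQ n c1 c2 c3 X), (limitY n c1 c2 c3 X).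
split; last by move=> i a; apply: limit_normalized.
  by move=> i a; have [dQ _ _ _] := approxP c1 c2 c3 hX (mdeg a); apply: dQ.
split=> [|i a|i a nS]; first exact: gnf_resonant_set.
  by have [_ dY _ _] := approxP c1 c2 c3 hX (mdeg a); apply: dY.
have [_ dY sY _] := approxP c1 c2 c3 hX (mdeg a).
(* In low degree the order of the perturbation suffices; above it the boolean and inductive
   descriptions of the positions agree. *)
have [lt_a|ge_a] := ltnP (chi n.+1).+1 (mdeg a); last exact: ord_ge_eq0 dY ge_a.
apply: sY; apply/negP => pos_a; apply: nS.
rewrite (mon_eta a); apply/gnf_positionP => //.
by move: lt_a; rewrite {1}(mon_eta a) mdeg_mon chiS; lia.
Qed.
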